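(* Let $a<b$, $\alpha\in(0,1)$, $p,q\in\mathbb{R}$, $P=\langle a,t,b,p,q\rangle$, $P^*=\langle a,t,b,q,p\rangle$, and let $k_{1-\alpha}$ be a kernel on $[a,b]\times[a,b]$. Suppose $f\in AC([a,b])$ and $K_{P^*}^{1-\alpha}[g]\in AC([a,b])$, and suppose that one of the following holds: (i) $k_{1-\alpha}$ is square integrable on $[a,b]\times[a,b]$ and $f',g\in L_2([a,b])$; or (ii) $k_{1-\alpha}(x,t)=k_{1-\alpha}(x-t)$ with $k_{1-\alpha}\in L_1([0,b-a])$, $f'\in L_1([a,b])$ and $g\in C([a,b])$. Then $$\int_a^b g(x)\,B_P^\alpha[f](x)\,dx=\Big[f(x)\,K_{P^*}^{1-\alpha}[g](x)\Big]_{x=a}^{x=b}-\int_a^b f(x)\,A_{P^*}^\alpha[g](x)\,dx .$$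
   Context: For a parameter set $P=\langle a,t,b,p,q\rangle$ and kernel $k_{1-\alpha}$, $K_P^{1-\alpha}[f](t)=p\int_a^t k_{1-\alpha}(t,\tau)f(\tau)\,d\tau+q\int_t^b k_{1-\alpha}(\tau,t)f(\tau)\,d\tau$. The generalized Riemann–Liouville derivative is $A_P^\alpha[f]=\frac{d}{dt}K_P^{1-\alpha}[f]$ (defined when $K_P^{1-\alpha}[f]$ is absolutely continuous) and the generalized Caputo derivative is $B_P^\alpha[f]=K_P^{1-\alpha}[f']$ (for $f$ absolutely continuous). $P^*$ denotes the parameter set with $p$ and $q$ interchanged. *)

(* Defs.v *)
From HB Require Import structures.
From mathcomp Require Import all_boot all_order all_algebra.
From mathcomp Require Import all_classical all_reals all_analysis.
Set Implicit Arguments. Unset Strict Implicit. Unset Printing Implicit Defensive.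
Import Order.TTheory GRing.Theory Num.Theory.
Import numFieldNormedType.Exports.
Local Open Scope classical_set_scope.
Local Open Scope ring_scope.

Definition abs_continuous_on (R : realType) (a b : R) (f : R -> R) : Prop :=
  forall eps : R, 0 < eps -> exists2 delta : R, 0 < delta &
    forall (n : nat) (s t : 'I_n -> R),
      (forall i, a <= s i /\ s i <= t i /\ t i <= b) ->
      (forall i j, i != j -> t i <= s j \/ t j <= s i) ->
      \sum_(i < n) (t i - s i) < delta ->
      \sum_(i < n) `|f (t i) - f (s i)| < eps.

Definition KP (R : realType) (a b p q : R) (k : R -> R -> R) (h : R -> R)
    (t : R) : R :=
  p * Rintegral lebesgue_measure `[a, t] (fun tau => k t tau * h tau)
  + q * Rintegral lebesgue_measure `[t, b] (fun tau => k tau t * h tau).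

Definition AP (R : realType) (a b p q : R) (k : R -> R -> R) (h : R -> R) :
    R -> R :=
  derive1 (KP a b p q k h).

Definition BP (R : realType) (a b p q : R) (k : R -> R -> R) (h : R -> R) :
    R -> R :=
  KP a b p q k (derive1 h).

Definition L2on (R : realType) (a b : R) (h : R -> R) : Prop :=
  measurable_fun `[a, b] h /\
  lebesgue_measure.-integrable `[a, b] (fun x => ((h x) ^+ 2)%:E).

Definition L1on (R : realType) (a b : R) (h : R -> R) : Prop :=
  lebesgue_measure.-integrable `[a, b] (fun x => (h x)%:E).

(* Main.v *)
(** The kernel operator with [p] and [q] interchanged is the adjoint of the
    original one: by Fubini on the triangle [a <= t <= x <= b], the integral of
    [g * KP p q f'] equals the integral of [f' * KP q p g]. What remains is an
    integration by parts for the absolutely continuous functions [f] and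
    [KP q p g]. It rests on the fundamental theorem of calculus for absolutely
    continuous functions: such a function is a difference of two nondecreasing
    absolutely continuous ones, whose Lebesgue-Stieltjes measures are dominated by
    the Lebesgue measure; the Radon-Nikodym densities represent the function as an
    indefinite integral, and the Lebesgue differentiation theorem identifies the
    density with the derivative almost everywhere.

    Fubini applies in case (i) because [2 |g k f'| <= k^2 + (g f')^2], and in case
    (ii) by Tonelli and the translation invariance of the Lebesgue measure. *)

Require Import Defs.
From HB Require Import structures.
From mathcomp Require Import all_boot all_order all_algebra.
From mathcomp Require Import all_classical all_reals all_analysis.
From mathcomp Require Import measurable_realfun ring lra.
Set Implicit Arguments. Unset Strict Implicit. Unset Printing Implicit Defensive.
Import Order.TTheory GRing.Theory Num.Theory.
Import numFieldNormedType.Exports.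
Local Open Scope classical_set_scope.
Local Open Scope ring_scope.

(** * Integrals of almost everywhere equal functions *)

Section integral_negligible.
Context {d : measure_display} {T : measurableType d} {R : realType}.
Variable mu : {measure set T -> \bar R}.
Local Open Scope ereal_scope.
Import HBNNSimple.

(** The integral of a nonnegative function is the supremum of the integrals of the simple functions
    below it. Setting such a function to zero on the null set [N] keeps its integral and puts it
    below [g], so measurability of [f] and [g] never enters. *)
Lemma ge0_le_integral_ae (f g : T -> \bar R) :
  (forall x, 0 <= f x) -> (forall x, 0 <= g x) ->
  {ae mu, forall x, f x = g x} -> \int[mu]_x f x <= \int[mu]_x g x.
Proof.
move=> f0 g0 [N [mN N0 fgN]].
rewrite (ge0_integralTE _ f0); apply: ge_ereal_sup => _ [h hf <-].
pose h' := proj_nnsfun h (measurableC mN).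
have -> : sintegral mu h = \int[mu]_x (h' x)%:E.
  rewrite -integralT_nnsfun; apply: ae_eq_integral => //;
    [exact/measurable_EFinP|exact/measurable_EFinP|].
  exists N; split => // x /= hx; apply: contrapT => Nx; apply: hx => _.
  by rewrite /h' /= mindicE mem_set// mulr1.
rewrite integralT_nnsfun (ge0_integralTE _ g0).
apply: ereal_sup_ubound; exists h' => // x.
rewrite /h' /= mindicE.
have [/set_mem xN|] := boolP (x \in ~` N); last by rewrite mulr0.
rewrite mulr1; apply: le_trans (hf x) _.
rewrite (_ : f x = g x) //; apply: contrapT => fg; exact/xN/fgN.
Qed.

(* Stated without measurability so as to apply to [derive1], whose values where
   the derivative does not exist are junk. *)
Lemma integral_ae_eqW (D : set T) (f g : T -> \bar R) :
  {ae mu, forall x, D x -> f x = g x} ->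
  \int[mu]_(x in D) f x = \int[mu]_(x in D) g x.
Proof.
move=> fg; rewrite integral_mkcond [RHS]integral_mkcond.
have {fg} : {ae mu, forall x, (f \_ D) x = (g \_ D) x}.
  apply: filterS fg => x fg; rewrite !patchE.
  by case: ifPn => // /set_mem/fg.
move: (f \_ D) (g \_ D) => {}f {}g fg.
have eqpos : {ae mu, forall x, f^\+ x = g^\+ x}.
  by apply: filterS fg => x fg; rewrite !funeposE fg.
have eqneg : {ae mu, forall x, f^\- x = g^\- x}.
  by apply: filterS fg => x fg; rewrite !funenegE fg.
have sym (u v : T -> \bar R) : {ae mu, forall x, u x = v x} ->
  {ae mu, forall x, v x = u x} by apply: filterS.
rewrite integralE [RHS]integralE; congr (_ - _); apply/eqP; rewrite eq_le;
  apply/andP; split; apply: ge0_le_integral_ae => //; exact: sym.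
Qed.

Lemma Rintegral_ae_eqW (D : set T) (f g : T -> R) :
  {ae mu, forall x, D x -> f x = g x} ->
  Rintegral mu D f = Rintegral mu D g.
Proof.
move=> fg; congr fine; apply: integral_ae_eqW.
by apply: filterS fg => x fg Dx; rewrite fg.
Qed.

End integral_negligible.

(** * Absolute continuity over finite families of segments *)

Section interval_families.
Context {R : realType}.
Implicit Types (a b : R) (f g : R -> R) (u v w : R * R) (l s : seq (R * R)).

Definition nonoverlap u v : bool := (u.2 <= v.1) || (v.2 <= u.1).

Definition segments_in a b l : bool :=
  all (fun u => [&& a <= u.1, u.1 <= u.2 & u.2 <= b]) l.

Definition family_length l : R := \sum_(u <- l) (u.2 - u.1).

Definition family_variation f l : R := \sum_(u <- l) `|f u.2 - f u.1|.

(** Families are lists here, so that they can be concatenated, refined and treated by induction. *)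
Definition abs_continuous_seq a b f : Prop :=
  forall eps : R, 0 < eps -> exists2 delta : R, 0 < delta &
    forall l, segments_in a b l -> pairwise nonoverlap l ->
      family_length l < delta -> family_variation f l < eps.

Lemma nonoverlapC u v : nonoverlap u v = nonoverlap v u.
Proof. exact: orbC. Qed.

Lemma nonoverlapW u v w : v.1 <= w.1 -> w.2 <= v.2 ->
  nonoverlap u v -> nonoverlap u w.
Proof.
move=> vw1 wv2 /orP[uv|vu]; apply/orP; first by left; exact: le_trans vw1.
by right; exact: le_trans vu.
Qed.

Lemma abs_continuous_onP a b f :
  abs_continuous_on a b f <-> abs_continuous_seq a b f.
Proof.
split=> acf eps eps0; have [delta delta0 acd] := acf eps eps0; exists delta => //.
  move=> l /allP labl sepl lend.
  pose x n : R * R := nth (0, 0) l n.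
  have := acd (size l) (fun i => (x i).1) (fun i => (x i).2).
  rewrite /family_length (big_nth (0, 0)) big_mkord in lend.
  rewrite /family_variation (big_nth (0, 0)) big_mkord.
  apply => //.
    move=> i; have xil : x i \in l by rewrite /x mem_nth.
    by have /and3P[-> -> ->] := labl _ xil.
  move=> i j ij; apply/orP; rewrite -/(nonoverlap (x i) (x j)).
  move/(pairwiseP (0, 0)) : sepl => sepl.
  have [ltij|ltji|eqij] := ltngtP i j; first by apply: sepl; rewrite ?inE.
    by rewrite nonoverlapC; apply: sepl; rewrite ?inE.
  by move: ij; rewrite (val_inj eqij) eqxx.
move=> n s t ab sep len.
pose l := [seq (s i, t i) | i <- index_enum 'I_n].
have -> : \sum_(i < n) `|f (t i) - f (s i)| = family_variation f l.
  by rewrite /family_variation big_map.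
apply: acd.
- apply/allP => _ /mapP[i _ ->] /=.
  by have [-> [-> ->]] := ab i.
- rewrite pairwise_map.
  have : uniq (index_enum 'I_n) by exact: index_enum_uniq.
  rewrite uniq_pairwise; apply: sub_pairwise => i j /= ij.
  exact/orP/sep.
- by rewrite /family_length big_map.
Qed.

(** A partition list omits its starting point; [pairmap] restores [a] as the left end of the first
    segment. *)
Definition partition_segments (a : R) (s : seq R) : seq (R * R) := pairmap pair a s.

Lemma variation_segments a b f (s : seq R) : itv_partition a b s ->
  variation a b f s = family_variation f (partition_segments a s).
Proof.
move=> abs; rewrite variation_zip// /family_variation /partition_segments.
elim: s a {abs} => [|x s ih] a /=; first by rewrite !big_nil.
by rewrite !big_cons /= ih.
Qed.

Lemma partition_segmentsP a b (s : seq R) : itv_partition a b s ->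
  [/\ segments_in a b (partition_segments a s),
      pairwise nonoverlap (partition_segments a s) &
      family_length (partition_segments a s) = b - a].
Proof.
rewrite /itv_partition => -[].
elim: s a => [|x s ih] a /=.
  by move=> _ /eqP ->; rewrite /family_length big_nil subrr.
move=> /andP[ax xs] /eqP sb; have [|h1 h2 h3] := ih x xs; first exact/eqP.
have xb : x <= b by apply: (@itv_partition_le _ _ x b s); split => //; exact/eqP.
have h1' : all (fun u => [&& x <= u.1, u.1 <= u.2 & u.2 <= b]) (pairmap pair x s).
  exact: h1.
split.
- rewrite /segments_in /= lexx (ltW ax) xb /=.
  apply: sub_all h1' => u /and3P[xu -> ->]; rewrite !andbT.
  by rewrite (le_trans _ xu)// ltW.
- rewrite h2 andbT; apply: sub_all h1' => u /and3P[xu _ _].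
  by rewrite /nonoverlap xu.
- by move: h3; rewrite /family_length big_cons /= => ->; rewrite addrC subrKA.
Qed.

End interval_families.

(** * Total variation of an absolutely continuous function *)

Section total_variation_abs_continuous.
Context {R : realType}.
Implicit Types (a b : R) (f g : R -> R) (l : seq (R * R)).
Local Notation TV := total_variation.

Lemma segments_in_cat a b l1 l2 :
  segments_in a b (l1 ++ l2) = segments_in a b l1 && segments_in a b l2.
Proof. exact: all_cat. Qed.

(* Each total variation is the supremum of the variations along partitions, and
   replacing a segment by the pieces of a partition of it keeps the family
   nonoverlapping and of the same length; the segments are replaced one by one. *)
Lemma total_variation_family_le a b f (eps delta : R) :
  (forall l, segments_in a b l -> pairwise nonoverlap l ->
    family_length l < delta -> family_variation f l <= eps) ->
  forall l1 l2, segments_in a b (l1 ++ l2) -> pairwise nonoverlap (l1 ++ l2) ->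
    family_length (l1 ++ l2) < delta ->
    (\sum_(u <- l1) TV u.1 u.2 f + (family_variation f l2)%:E <= eps%:E)%E.
Proof.
move=> acf; elim => [|u l1 ih] l2 /=.
  by move=> *; rewrite big_nil add0e lee_fin acf.
move=> /andP[/and3P[au uu ub] abl] /andP[ul sl].
move=> len; rewrite /family_length big_cons in len.
rewrite big_cons -addeA.
(* For a fixed partition [r] of the head segment, its pieces [P] join [l2] and the induction
   hypothesis applies. *)
have abu (r : seq R) (ur : itv_partition u.1 u.2 r) :
    (\sum_(u <- l1) TV u.1 u.2 f + (family_variation f l2)%:E
       + (variation u.1 u.2 f r)%:E <= eps%:E)%E.
  have [P1 P2 P3] := partition_segmentsP ur.
  rewrite (variation_segments f ur).
  set P := partition_segments u.1 r in P1 P2 P3 *.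
  have uP (v w : R * R) : w \in P -> nonoverlap u v -> nonoverlap v w.
    move=> /(allP P1) /and3P[uw _ wu]; rewrite nonoverlapC.
    exact: nonoverlapW.
  have := ih (l2 ++ P).
  rewrite /family_variation (big_cat _ l2 P) /= EFinD addeA; apply.
  - move: abl; rewrite !segments_in_cat => /andP[-> ->] /=.
    apply: sub_all P1 => w /and3P[uw -> wu].
    by rewrite (le_trans au uw) (le_trans wu ub).
  - have PE (l : seq (R * R)) : all (nonoverlap u) l -> allrel nonoverlap l P.
      move=> /allP ul'; apply/allrelP => v w vl wP; apply: (uP _ _ wP); exact: ul'.
    move: ul sl; rewrite all_cat => /andP[ul1 ul2].
    rewrite pairwise_cat => /and3P[l12 l11 l22].
    rewrite catA pairwise_cat P2 andbT pairwise_cat l12 l11 l22 /= andbT.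
    by rewrite PE// all_cat ul1 ul2.
  - rewrite /family_length catA big_cat/=.
    by rewrite -/(family_length P) P3 addrC.
have abu0 : (\sum_(u <- l1) TV u.1 u.2 f + (family_variation f l2)%:E <= eps%:E)%E.
  apply: ih => //; apply: le_lt_trans len.
  by rewrite lerDr subr_ge0.
(* Finiteness allows the other terms to be subtracted; what remains is a bound on a supremum over
   [r]. *)
have fin : (\sum_(u <- l1) TV u.1 u.2 f + (family_variation f l2)%:E)%E \is a fin_num.
  rewrite ge0_fin_numE; first exact: le_lt_trans abu0 (ltry _).
  apply: adde_ge0; last by rewrite lee_fin sumr_ge0.
  move: abl; rewrite segments_in_cat => /andP[/allP abl1 _].
  rewrite big_seq sume_ge0// => v /abl1 /and3P[_ vv _].
  exact: total_variation_ge0.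
rewrite -leeBrDr//; apply: ge_ereal_sup => _ /= [_ [r ur <-] <-].
by rewrite leeBrDr// addeC; exact: abu.
Qed.

Lemma abs_continuous_seq_TV a b f (eps : R) : 0 < eps ->
  abs_continuous_seq a b f -> exists2 delta : R, 0 < delta &
    forall l, segments_in a b l -> pairwise nonoverlap l ->
      family_length l < delta -> (\sum_(u <- l) TV u.1 u.2 f <= eps%:E)%E.
Proof.
move=> eps0 /(_ eps eps0)[delta delta0 acf]; exists delta => // l abl sl len.
have := @total_variation_family_le a b f eps delta _ l [::].
rewrite cats0 /family_variation big_nil adde0; apply => //.
by move=> l' abl' sl' len'; exact/ltW/acf.
Qed.

(** Segments shorter than the [delta] associated with 1 have total variation at most 1. Finitely
    many steps of length [delta / 2] reach any point from [a], and total variation is additive. *)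
Lemma abs_continuous_seq_bounded_variation a b f : a <= b ->
  abs_continuous_seq a b f -> bounded_variation a b f.
Proof.
move=> ab /(abs_continuous_seq_TV ltr01)[delta delta0 acf].
apply/bounded_variationP => //.
suff H n x : a <= x -> x <= b -> x - a < n%:R * (delta / 2) -> TV a x f \is a fin_num.
  have [n bn] : exists n : nat, b - a < n%:R * (delta / 2).
    exists (Num.truncn ((b - a) / (delta / 2))).+1.
    by rewrite -ltr_pdivrMr ?divr_gt0// truncnS_gt.
  exact: (H n).
elim: n x => [|n ih] x ax xb.
  by rewrite mul0r subr_lt0 ltNge ax.
have short y : a <= y -> y <= x -> x - y < delta -> TV y x f \is a fin_num.
  move=> ay yx xy; rewrite ge0_fin_numE ?total_variation_ge0//.
  apply: le_lt_trans (ltry 1).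
  have := acf [:: (y, x)]; rewrite big_seq1; apply => //=.
    by rewrite /segments_in /= ay yx xb.
  by rewrite /family_length big_seq1.
move=> xn; have [xd|xd] := ltP (x - a) (delta / 2).
  apply: short => //; apply: lt_trans xd _.
  by rewrite ltr_pdivrMr// ltr_pMr// ltr1n.
have ay : a <= x - delta / 2 by rewrite lerBrDr addrC -lerBrDr.
have yx : x - delta / 2 <= x by rewrite gerBl divr_ge0// ltW.
rewrite (total_variationD f ay yx) fin_numD ih//=; last 2 first.
- exact: le_trans yx xb.
- by rewrite addrAC ltrBlDr; move: xn; rewrite -natr1 mulrDl mul1r.
apply: short => //.
by rewrite opprB addrCA subrr addr0 ltr_pdivrMr// ltr_pMr// ltr1n.
Qed.

Lemma abs_continuous_seqB a b f g : abs_continuous_seq a b f ->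
  abs_continuous_seq a b g -> abs_continuous_seq a b (fun x => f x - g x).
Proof.
move=> acf acg eps eps0; have eps20 : 0 < eps / 2 by rewrite divr_gt0.
have [d1 d10 {}acf] := acf _ eps20; have [d2 d20 {}acg] := acg _ eps20.
exists (Num.min d1 d2); first by rewrite lt_min d10.
move=> l abl sl; rewrite lt_min => /andP[l1 l2].
rewrite [ltRHS]splitr; apply: le_lt_trans (ltrD (acf _ abl sl l1) (acg _ abl sl l2)).
rewrite /family_variation -big_split /=; apply: ler_sum => u _.
rewrite (_ : _ - _ = f u.2 - f u.1 - (g u.2 - g u.1)); last by ring.
exact: ler_normB.
Qed.

(* The total variation of [f] on the segment from [a] to [x] serves as [v x]. *)
Lemma abs_continuous_seq_decomp a b f : a <= b -> abs_continuous_seq a b f ->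
  exists v w : R -> R,
  [/\ abs_continuous_seq a b v, abs_continuous_seq a b w,
      {in `[a, b] &, {homo v : x y / x <= y}},
      {in `[a, b] &, {homo w : x y / x <= y}} &
      forall x, f x = v x - w x].
Proof.
move=> ab acf; have bvf := abs_continuous_seq_bounded_variation ab acf.
have TVfin x y : a <= x -> x <= y -> y <= b -> TV x y f \is a fin_num.
  move=> ax xy yb; apply/bounded_variationP => //.
  by apply: (bounded_variationl xy yb); apply: (bounded_variationr ax _ bvf); exact: le_trans yb.
pose v x := fine (TV a x f).
have vD x y : a <= x -> x <= y -> y <= b -> v y - v x = fine (TV x y f).
  move=> ax xy yb; rewrite /v (total_variationD f ax xy) fineD ?TVfin//.
    by rewrite addrAC subrr add0r.
  exact: le_trans yb.
have acv : abs_continuous_seq a b v.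
  (* The supremum only gives a non-strict bound; halving [eps] restores strictness. *)
  move=> eps eps0; have eps20 : 0 < eps / 2 by rewrite divr_gt0.
  have [delta delta0 acd] := abs_continuous_seq_TV eps20 acf.
  exists delta => // l abl sl len; have := acd l abl sl len.
  have -> : (\sum_(u <- l) TV u.1 u.2 f)%E = (family_variation v l)%:E.
    rewrite /family_variation -sumEFin big_seq [RHS]big_seq; apply: eq_bigr => u.
    move=> /(allP abl)/and3P[au uu ub].
    by rewrite vD// ger0_norm ?fineK ?TVfin// fine_ge0 ?total_variation_ge0.
  rewrite lee_fin => /le_lt_trans; apply.
  by rewrite ltr_pdivrMr// ltr_pMr// ltr1n.
(* The second function is nondecreasing because an increment of [f] is at most its total variation
   on that segment. *)
exists v, (fun x => v x - f x); split => //.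
- exact: abs_continuous_seqB.
- move=> x y; rewrite !in_itv/= => /andP[ax _] /andP[_ yb] xy.
  by rewrite -subr_ge0 vD// fine_ge0// total_variation_ge0.
- move=> x y; rewrite !in_itv/= => /andP[ax _] /andP[_ yb] xy.
  have vxy := vD x y ax xy yb.
  suff : f y - f x <= v y - v x by lra.
  rewrite vxy -lee_fin fineK ?TVfin//.
  by apply: le_trans (total_variation_ge f xy); rewrite lee_fin ler_norm.
- by move=> x; rewrite opprB addrCA subrr addr0.
Qed.

End total_variation_abs_continuous.

(** * Radon-Nikodym density of a monotone absolutely continuous function *)

Section disjointification.
Context {R : realType}.
Implicit Types (a b x : R) (u v w : R * R) (l : seq (R * R)).

(** Half-open intervals: nonoverlapping segments give disjoint ones, and Stieltjes measures are
    explicit on them. *)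
Definition in_oc x u : bool := u.1 < x <= u.2.

Definition oc_cover l : set R := [set x | has (in_oc x) l].

(** The set difference of the half-open intervals of [u] and [v]: at most two pieces, the empty ones
    being filtered out. *)
Definition cut v u : seq (R * R) :=
  [seq w <- [:: (u.1, Num.min u.2 v.1); (Num.max u.1 v.2, u.2)] | w.1 < w.2].

Lemma in_oc_lt x u : in_oc x u -> u.1 < u.2.
Proof. by move=> /andP[/lt_le_trans h /h]. Qed.

Lemma has_cut v u x : v.1 <= v.2 ->
  has (in_oc x) (cut v u) = in_oc x u && ~~ in_oc x v.
Proof.
move=> vv; rewrite /cut has_filter -filter_predI -has_filter.
rewrite (@eq_has _ _ (in_oc x)); last first.
  move=> w /=; case: (boolP (in_oc x w)) => //= /in_oc_lt ->//.
rewrite /= orbF /in_oc /= le_min gt_max negb_and -leNgt -ltNge.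
by case: (ltP u.1 x); case: (leP x u.2); case: (leP x v.1); case: (ltP v.2 x).
Qed.

Lemma cutP v u w : v.1 <= v.2 -> w \in cut v u ->
  [/\ u.1 <= w.1, w.1 <= w.2, w.2 <= u.2 & nonoverlap v w].
Proof.
move=> vv; rewrite mem_filter => /andP[ww]; rewrite !inE => /orP[] /eqP wE.
  by move: ww; rewrite wE /nonoverlap /= => /ltW ?; split;
    rewrite ?ge_min ?lexx ?orbT.
by move: ww; rewrite wE /nonoverlap /= => /ltW ?; split;
  rewrite ?le_max ?lexx ?orbT.
Qed.

Lemma pairwise_cut v u : v.1 <= v.2 -> pairwise nonoverlap (cut v u).
Proof.
move=> vv; apply: pairwise_filter; rewrite /= !andbT /nonoverlap /=.
by rewrite ge_min !le_max vv !orbT.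
Qed.

(** By induction: the head [v] is kept whole and cut out of every segment of the family already made
    nonoverlapping. *)
Lemma disjointify a b l : segments_in a b l -> exists l',
  [/\ segments_in a b l', pairwise nonoverlap l' &
      forall x, has (in_oc x) l' = has (in_oc x) l].
Proof.
elim: l => [|v l ih] /=; first by exists [::].
move=> /andP[/and3P[av vv vb] /ih[l' [abl sl El]]].
exists (v :: flatten [seq cut v u | u <- l']); split.
- rewrite /segments_in /= av vv vb /=; apply/allP => w /flatten_mapP[u ul].
  move=> /(cutP vv)[uw -> wu _] /=.
  have /and3P[au _ ub] := allP abl _ ul.
  by rewrite (le_trans au uw) (le_trans wu ub).
- rewrite /=; apply/andP; split.
    by apply/allP => w /flatten_mapP[u _ /(cutP vv)[]].
  elim: l' sl {abl El} => //= u l' ihl /andP[ul sl].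
  rewrite pairwise_cat pairwise_cut// ihl// !andbT.
  apply/allrelP => w w' /(cutP vv)[uw _ wu _] /flatten_mapP[u' ul' /(cutP vv)[uw' _ wu' _]].
  rewrite nonoverlapC; apply: (nonoverlapW uw wu); rewrite nonoverlapC.
  by apply: (nonoverlapW uw' wu'); exact: (allP ul).
- move=> x /=; rewrite -El; apply/idP/idP.
    move=> /orP[->//|/hasP[w /flatten_mapP[u ul wu] xw]]; apply/orP; right.
    apply/hasP; exists u => //.
    suff : has (in_oc x) (cut v u) by rewrite has_cut// => /andP[].
    by apply/hasP; exists w.
  have [//|xv] /= := boolP (in_oc x v).
  move=> /hasP[u ul xu].
  have /hasP[w wu xw] : has (in_oc x) (cut v u) by rewrite has_cut// xu.
  by apply/hasP; exists w => //; apply/flatten_mapP; exists u.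
Qed.

Lemma oc_cover_cons u l : oc_cover (u :: l) = `]u.1, u.2]%classic `|` oc_cover l.
Proof.
apply/seteqP; split => x; rewrite /oc_cover /= in_itv /=.
  by move=> /orP[]; [left|right].
by move=> [] h; apply/orP; [left|right].
Qed.

Lemma oc_cover_nil : oc_cover [::] = set0.
Proof. by apply/seteqP; split => x. Qed.

Lemma measurable_oc_cover l : measurable (oc_cover l).
Proof.
elim: l => [|u l ih]; first by rewrite oc_cover_nil.
by rewrite oc_cover_cons; apply: measurableU.
Qed.

(** Finite additivity over disjoint half-open intervals, for a general [F] so as to serve both the
    Lebesgue measure and a Stieltjes measure. *)
Lemma measure_oc_cover (m : {measure set (measurableTypeR R) -> \bar R}) (F : R -> R) a b l :
  (forall s t, s <= t -> m `]s, t]%classic = (F t - F s)%:E) ->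
  segments_in a b l -> pairwise nonoverlap l ->
  m (oc_cover l) = (\sum_(u <- l) (F u.2 - F u.1))%:E.
Proof.
move=> mF; elim: l => [|u l ih] /=.
  by rewrite oc_cover_nil measure0 big_nil.
move=> /andP[/and3P[au uu ub] abl] /andP[ul sl].
rewrite oc_cover_cons measureU//; last 2 first.
- exact: measurable_oc_cover.
- apply/seteqP; split => // x [] /=; rewrite in_itv /= => /andP[ux xu].
  move=> /hasP[v vl /andP[vx xv]].
  have /orP[] := allP ul _ vl; apply/negP; rewrite -ltNge.
    exact: lt_le_trans vx xu.
  exact: lt_le_trans ux xv.
rewrite big_cons EFinD; congr (_ + _)%E; [exact: mF|exact: ih].
Qed.

End disjointification.

(** * The Lebesgue-Stieltjes measure of a monotone function and its density *)

Section monotone_abs_continuous.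
Context {R : realType}.
Implicit Types (a b x : R) (V : R -> R).
Local Notation mu := (@lebesgue_measure R).

Lemma lebesgue_stieltjes_measure_oc (F : cumulative R R) (s t : R) : s <= t ->
  lebesgue_stieltjes_measure F `]s, t]%classic = (F t - F s)%:E.
Proof.
move=> st; rewrite /lebesgue_stieltjes_measure /measure_extension.
by rewrite measurable_mu_extE/= ?wlength_itv_bnd//; exact: is_ocitv.
Qed.

Lemma lebesgue_measure_oc (s t : R) : s <= t ->
  mu `]s, t]%classic = (idfun t - idfun s)%:E.
Proof. exact: (@lebesgue_stieltjes_measure_oc idfun). Qed.

(** The Lebesgue measure is constructed as an infimum over countable covers by half-open intervals;
    a cover of total length below [delta] exists, and subadditivity bounds its union. *)
Lemma lebesgue_measure_ocitv_cover (A : set R) (delta : R) : 0 < delta ->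
  mu A = 0%E -> exists p : nat -> R * R,
    A `<=` \bigcup_k `](p k).1, (p k).2]%classic /\
    (mu (\bigcup_k `](p k).1, (p k).2]%classic) < delta%:E)%E.
Proof.
move=> delta0 A0.
have : (mu A < delta%:E)%E by rewrite A0 lte_fin.
rewrite /lebesgue_measure /lebesgue_stieltjes_measure /measure_extension /mu_ext.
move=> /ereal_inf_lt[_ [F [mF AF] <-]] Fdelta.
have /choice[p pE] : forall k, exists u : R * R, `]u.1, u.2]%classic = F k.
  by move=> k; have [u _ uE] := mF k; exists u.
exists p; split; first by under eq_bigcupr do rewrite pE.
apply: le_lt_trans Fdelta.
have := @measure_sigma_subadditive _ _ _ mu (\bigcup_k F k) F.
rewrite (eq_bigcupr (fun k _ => pE k)).
have mF' k : measurable (F k : set R) by rewrite -pE.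
move=> H; apply: le_trans (H mF' (bigcup_measurable (fun k _ => mF' k)) _) _ => //.
apply: lee_nneseries => // k _.
suff muE (X : set (ocitv_type R)) : ocitv X -> mu X = wlength idfun X.
  by rewrite le_eqVlt; apply/orP; left; apply/eqP; exact: muE (mF k).
move=> oX; rewrite /lebesgue_measure/= /lebesgue_stieltjes_measure/= /measure_extension/=.
by rewrite measurable_mu_extE.
Qed.

Definition clamp a b x := Num.max a (Num.min x b).

Lemma clamp_in a b x : a <= b -> a <= clamp a b x <= b.
Proof. by move=> ab; rewrite /clamp le_max lexx ge_max ab ge_min lexx orbT. Qed.

Lemma clamp_id a b x : a <= x <= b -> clamp a b x = x.
Proof. by move=> /andP[ax xb]; rewrite /clamp min_l// max_r. Qed.

Lemma clamp_homo a b x y : x <= y -> clamp a b x <= clamp a b y.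
Proof.
move=> xy; rewrite /clamp ge_max !le_max lexx /=; apply/orP; right.
by rewrite le_min !ge_min xy lexx orbT.
Qed.

(** Ensures that extending a function by constants outside [[a, b]] keeps its modulus of
    continuity. *)
Lemma clamp_lipschitz a b x y : x <= y -> clamp a b y - clamp a b x <= y - x.
Proof.
move=> xy; rewrite /clamp /Num.max /Num.min.
by repeat case: ifPn; rewrite -?leNgt; lra.
Qed.

Section monotone.
Variables (a b : R) (V : R -> R).
Hypotheses (ab : a <= b) (ndV : {in `[a, b] &, {homo V : x y / x <= y}}).
Hypothesis acV : abs_continuous_seq a b V.

(* Extending [V] by constants to the whole line makes it a cumulative function. *)
Let F x := V (clamp a b x).

Let F_nd : nondecreasing F.
Proof.
move=> x y xy; apply: ndV; rewrite ?in_itv/= ?clamp_in//.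
exact: clamp_homo.
Qed.

Let F_continuous : continuous F.
Proof.
move=> x; apply/cvgrPdist_lt => eps eps0.
have [delta delta0 acd] := acV eps0.
have close u v : u <= v -> v - u < delta -> `|F v - F u| < eps.
  move=> uv vu; have := acd [:: (clamp a b u, clamp a b v)].
  rewrite /family_length /family_variation !big_seq1; apply => //.
    rewrite /segments_in /= clamp_homo//.
    by have /andP[-> _] := clamp_in u ab; have /andP[_ ->] := clamp_in v ab.
  exact: le_lt_trans (clamp_lipschitz _ _ uv) vu.
near=> y.
have xy : `|x - y| < delta by near: y; apply: cvgr_dist_lt => //; exact: cvg_id.
have [lexy|ltyx] := leP x y.
  by rewrite distrC; apply: close => //; rewrite -(ger0_norm (_ : 0 <= y - x)) ?subr_ge0// distrC.
by apply: close; [exact: ltW | rewrite -(gtr0_norm (_ : 0 < x - y)) ?subr_gt0].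
Unshelve. all: by end_near. Qed.

HB.instance Definition _ :=
  isCumulative.Build R _ R F F_nd (right_continuousW F_continuous).

Let nu : {measure set (measurableTypeR R) -> \bar R} :=
  lebesgue_stieltjes_measure F.

Let nu_oc (s t : R) : s <= t -> nu `]s, t]%classic = (F t - F s)%:E.
Proof. exact: lebesgue_stieltjes_measure_oc. Qed.

Let D : set R := `]a, b]%classic.

Let mD : measurable (D : set (measurableTypeR R)). Proof. exact: measurable_itv. Qed.

Let nuD : (nu D < +oo)%E.
Proof. by rewrite nu_oc// ltry. Qed.

(** Once the family is made nonoverlapping, [mu] of the cover is its length and [nu] of the cover is
    a sum of increments of [V], which absolute continuity controls. *)
Let nu_cover_lt (eps : R) : 0 < eps -> exists2 delta : R, 0 < delta &
  forall l, segments_in a b l -> (mu (oc_cover l) < delta%:E)%E ->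
  (nu (oc_cover l) <= eps%:E)%E.
Proof.
move=> eps0; have [delta delta0 acd] := acV eps0; exists delta => // l abl.
have [l' [abl' sl' El]] := disjointify abl.
have <- : oc_cover l' = oc_cover l.
  by apply/seteqP; split => x; rewrite /oc_cover /= El.
rewrite (measure_oc_cover lebesgue_measure_oc abl' sl').
have -> : nu (oc_cover l') = _ := measure_oc_cover nu_oc abl' sl'.
rewrite lte_fin lee_fin => /(acd _ abl' sl')/ltW.
apply: le_trans; rewrite /family_variation big_seq [leRHS]big_seq.
apply: ler_sum => u /(allP abl') /and3P[au uu ub].
rewrite /F !clamp_id ?ler_norm//; first by rewrite au (le_trans uu).
by rewrite ub andbT (le_trans au).
Qed.

(** A null set is covered by countably many half-open intervals of small measure. Clipped to
    [[a, b]], their finite subfamilies have [nu]-measure at most [eps], and continuity from below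
    passes the bound to the union. *)
Let nu_dominates : mfrestr mD nuD `<< mu.
Proof.
apply/null_content_dominatesP => A mA A0.
apply/eqP; rewrite eq_le measure_ge0 andbT.
apply/lee_addgt0Pr => eps eps0; rewrite add0e.
have [delta delta0 Hd] := nu_cover_lt eps0.
have [p [Ap pd]] := lebesgue_measure_ocitv_cover delta0 A0.
pose clip k : R * R := (Num.max a (p k).1, Num.min b (p k).2).
(* Clipping an interval that misses []a, b]] may reverse its ends; the filter drops such pairs. *)
pose l n := [seq u <- [seq clip k | k <- iota 0 n] | u.1 < u.2].
have lP n x : oc_cover (l n) x <-> exists2 k, (k < n)%N & in_oc x (clip k).
  rewrite /oc_cover /= /l; split.
    move=> /hasP[u]; rewrite mem_filter => /andP[_ /mapP[k + ->] xu].
    by rewrite mem_iota add0n => kn; exists k.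
  move=> [k kn xk]; apply/hasP; exists (clip k) => //.
  by rewrite mem_filter (in_oc_lt xk) map_f// mem_iota.
have clipP k x : in_oc x (clip k) = in_oc x (a, b) && in_oc x (p k).
  by rewrite /in_oc /clip /= gt_max le_min andbACA.
have abl n : segments_in a b (l n).
  apply/allP => u; rewrite mem_filter => /andP[uu /mapP[k _ uE]].
  by rewrite (ltW uu) uE /clip /= le_max lexx ge_min lexx.
have mp : measurable (\bigcup_k `](p k).1, (p k).2]%classic).
  by apply: bigcup_measurable => k _; exact: measurable_itv.
have nul n : (nu (oc_cover (l n)) <= eps%:E)%E.
  apply: Hd => //; apply: le_lt_trans pd; apply: le_measure; rewrite ?inE//.
    exact: measurable_oc_cover.
  move=> x /lP[k _]; rewrite clipP => /andP[_ xk].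
  by exists k.
have lU : A `&` D `<=` \bigcup_n oc_cover (l n).
  move=> x [/Ap[k _ /= xk] Dx]; exists k.+1 => //; apply/lP; exists k => //.
  rewrite clipP; move: Dx xk; rewrite /D /in_oc /= !in_itv/= => -> //.
have mU : measurable (\bigcup_n oc_cover (l n)).
  by apply: bigcup_measurable => n _; exact: measurable_oc_cover.
apply: (@le_trans _ _ (nu (\bigcup_n oc_cover (l n)))).
  rewrite /= /mfrestr /mrestr; apply: le_measure; rewrite ?inE//.
  exact: measurableI.
have cvgU : (nu \o (fun n => oc_cover (l n))) n @[n --> \oo] -->
    nu (\bigcup_n oc_cover (l n)).
  apply: nondecreasing_cvg_mu => //; first by move=> n; exact: measurable_oc_cover.
  move=> m n mn; apply/subsetPset => x /lP[k km xk]; apply/lP; exists k => //.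
  exact: leq_trans mn.
rewrite -(cvg_lim _ cvgU)//; apply: lime_le; first by apply/cvg_ex; eexists; exact: cvgU.
exact: nearW.
Qed.

(** The Radon-Nikodym density of [nu] restricted to []a, b]] is taken; the measure of []a, x]] is
    [V x - V a]. *)
Lemma monotone_abs_continuous_integral : exists2 h : R -> R,
  mu.-integrable setT (EFin \o h) &
  forall x, a <= x <= b -> V x - V a = Rintegral mu `[a, x] h.
Proof.
have [h [h0 hfin hint hE]] := @radon_nikodym_sigma_finite _ _ _
  (@lebesgue_measure R) (mfrestr mD nuD) nu_dominates.
(* The density is extended-real-valued but finite everywhere, so [fine] loses nothing. *)
have hh : EFin \o (fine \o h) = h by apply/funext => x /=; rewrite fineK.
exists (fine \o h); first by rewrite hh.
move=> x /andP[ax xb].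
rewrite -Rintegral_itv_obnd_cbnd; last first.
  by rewrite hh; apply: integrableS hint.
rewrite /Rintegral -[X in fine (integral _ _ X)]/(EFin \o (fine \o h)) hh -hE;
  last exact: measurable_itv.
rewrite /= /mfrestr /mrestr setIidl; last first.
  by move=> y /=; rewrite /D /= !in_itv/= => /andP[-> /le_trans]; exact.
by rewrite nu_oc//= /F !clamp_id ?lexx ?ax.
Qed.

End monotone.
End monotone_abs_continuous.

(** * Calculus of absolutely continuous functions *)

Section abs_continuous_calculus.
Context {R : realType}.
Implicit Types (a b x : R) (f g h : R -> R).
Local Notation mu := (@lebesgue_measure R).

Lemma abs_continuous_seq_integral a b f : a <= b -> abs_continuous_seq a b f ->
  exists2 h : R -> R, mu.-integrable setT (EFin \o h) &
    forall x, a <= x <= b -> f x - f a = Rintegral mu `[a, x] h.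
Proof.
move=> ab /(abs_continuous_seq_decomp ab)[v [w [acv acw ndv ndw fE]]].
have [hv hvint hvE] := monotone_abs_continuous_integral ab ndv acv.
have [hw hwint hwE] := monotone_abs_continuous_integral ab ndw acw.
exists (fun x => hv x - hw x).
  have -> : EFin \o (fun x => hv x - hw x) = ((EFin \o hv) \- (EFin \o hw))%E.
    by apply/funext => x /=; rewrite EFinB.
  exact: integrableB.
move=> x xab; rewrite RintegralB//.
- by rewrite -hvE// -hwE// !fE; ring.
- exact: integrableS hvint.
- exact: integrableS hwint.
Qed.

(** The indefinite integral of the density is differentiable almost everywhere with derivative [h],
    and [f] differs from it by a constant on [[a, b]]. *)
Lemma abs_continuous_seq_derive a b f : a < b -> abs_continuous_seq a b f ->
  exists h : R -> R, [/\ mu.-integrable setT (EFin \o h),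
    forall x, a <= x <= b -> f x - f a = Rintegral mu `[a, x] h &
    {ae mu, forall x, `[a, b]%classic x -> is_derive x 1 f (h x)}].
Proof.
move=> ab acf; have [h hint hE] := abs_continuous_seq_integral (ltW ab) acf.
have aeF := ae_filter_ringOfSetsType mu.
exists h; split => //.
pose F x := Rintegral mu `[a, x] h.
have hint' y : mu.-integrable [set` Interval (BLeft a) (BRight y)] (EFin \o h).
  exact: integrableS hint.
have hloc : locally_integrable setT h.
  have := integrable_locally measurableT hint; by rewrite patch_setT.
have FD := FTC1 hint' hloc.
(* The endpoints are discarded as null sets: there a two-sided derivative depends on values of [f]
   outside [[a, b]]. *)
have neab c : {ae mu, forall x : R, x <> c}.
  exists [set c]; split => //; first exact: lebesgue_measure_set1.
  by move=> x /= /contrapT.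
apply: filterS3 FD (neab a) (neab b) => x FD xa xb.
rewrite /= in_itv/= => /andP[ax bx].
have {ax xa} ax : a < x by rewrite lt_neqAle ax andbT; apply/eqP/nesym.
have {bx xb} bx : x < b by rewrite lt_neqAle bx andbT; apply/eqP.
have [dF F'] : derivable F x 1 /\ derive1 F x = h x by apply: FD; rewrite /= lte_fin.
apply: (@near_eq_is_derive _ _ _ (cst (f a) \+ F)).
  have : x \in `]a, b[ by rewrite in_itv/= ax.
  move=> /near_in_itvoo; apply: filterS => y; rewrite in_itv/= => /andP[ay yb].
  by rewrite /= /F -hE ?(ltW ay) ?(ltW yb)// addrC subrK.
rewrite -F' derive1E -[X in is_derive _ _ _ X]add0r.
by apply: is_deriveD; exact: derivableP.
Qed.

Lemma abs_continuous_seq_continuous a b f : a <= b -> abs_continuous_seq a b f ->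
  {within `[a, b], continuous f}.
Proof.
move=> ab acf; have [h hint hE] := abs_continuous_seq_integral ab acf.
have : {within `[a, b], continuous (fun x => f a + parameterized_integral mu a x h)}.
  move=> x; apply: cvgD; first exact: cvg_cst.
  by apply: parameterized_integral_continuous => //; exact: integrableS hint.
apply: subspace_eq_continuous => x; rewrite inE /= in_itv/= => xab.
by rewrite /from_subspace /= /parameterized_integral -hE// addrC subrK.
Qed.

Lemma continuous_within_bounded a b f : a <= b -> {within `[a, b], continuous f} ->
  exists2 M : R, 0 < M & forall x, a <= x <= b -> `|f x| <= M.
Proof.
move=> ab cf.
have [c _ fc] := EVT_max ab cf; have [d _ fd] := EVT_min ab cf.
(* The summand 1 makes the bound positive, hence a legitimate divisor. *)
exists (`|f c| + `|f d| + 1) => [|x xab]; first by rewrite ltr_wpDl// addr_ge0.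
have xI : x \in `[a, b] by rewrite in_itv.
have := fc _ xI; have := fd _ xI; rewrite ler_norml.
have := ler_norm (f c); have := ler_norm (- f d); rewrite normrN.
by have := normr_ge0 (f c); have := normr_ge0 (f d); move=> *; apply/andP; split; lra.
Qed.

(** Both factors are bounded on [[a, b]], and an increment of the product splits into an increment
    of each factor times a value of the other. *)
Lemma abs_continuous_seqM a b f g : a <= b -> abs_continuous_seq a b f ->
  abs_continuous_seq a b g -> abs_continuous_seq a b (fun x => f x * g x).
Proof.
move=> ab acf acg.
have [M M0 fM] := continuous_within_bounded ab (abs_continuous_seq_continuous ab acf).
have [N N0 gN] := continuous_within_bounded ab (abs_continuous_seq_continuous ab acg).
move=> eps eps0.
have [d1 d10 {}acf] : exists2 delta : R, 0 < delta & forall l, segments_in a b l ->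
    pairwise nonoverlap l -> family_length l < delta -> family_variation f l < eps / 2 / N.
  by apply: acf; rewrite !divr_gt0.
have [d2 d20 {}acg] : exists2 delta : R, 0 < delta & forall l, segments_in a b l ->
    pairwise nonoverlap l -> family_length l < delta -> family_variation g l < eps / 2 / M.
  by apply: acg; rewrite !divr_gt0.
exists (Num.min d1 d2); first by rewrite lt_min d10.
move=> l abl sl; rewrite lt_min => /andP[/(acf _ abl sl) vf /(acg _ abl sl) vg].
rewrite ltr_pdivlMr// in vf; rewrite ltr_pdivlMr// in vg.
rewrite [ltRHS]splitr; apply: le_lt_trans (ltrD vf vg).
rewrite /family_variation !mulr_suml -big_split /= big_seq [leRHS]big_seq.
apply: ler_sum => u /(allP abl)/and3P[au uu ub].
rewrite (_ : _ - _ = (f u.2 - f u.1) * g u.2 + (g u.2 - g u.1) * f u.1); last by ring.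
apply: le_trans (ler_normD _ _) _; rewrite !normrM lerD// ler_wpM2l//.
  by rewrite gN// ub (le_trans au).
by rewrite fM// au (le_trans uu).
Qed.

Lemma integrable_continuousM a b f h : a <= b -> {within `[a, b], continuous f} ->
  mu.-integrable `[a, b] (EFin \o h) ->
  mu.-integrable `[a, b] (EFin \o (fun x => f x * h x)).
Proof.
move=> ab cf hint.
have -> : EFin \o (fun x => f x * h x) = ((EFin \o f) \* (EFin \o h))%E.
  by apply/funext => x /=; rewrite EFinM.
have [M M0 fM] := continuous_within_bounded ab cf.
apply: integrableMr => //; first exact: subspace_continuous_measurable_fun.
exists M; split; first exact: num_real.
move=> N MN x /=; rewrite in_itv/= => /fM; move/le_trans; apply; exact: ltW.
Qed.

(** The product [f g] is absolutely continuous, hence the integral of its density, and the product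
    rule holds at almost every point of [[a, b]]. *)
Lemma abs_continuous_integration_by_parts a b f g : a < b ->
  abs_continuous_on a b f -> abs_continuous_on a b g ->
  Rintegral mu `[a, b] (fun x => derive1 f x * g x) =
  f b * g b - f a * g a - Rintegral mu `[a, b] (fun x => f x * derive1 g x).
Proof.
move=> ab /abs_continuous_onP acf /abs_continuous_onP acg.
have aeF := ae_filter_ringOfSetsType mu.
have leab := ltW ab.
have [hf [hfint _ hfD]] := abs_continuous_seq_derive ab acf.
have [hg [hgint _ hgD]] := abs_continuous_seq_derive ab acg.
have [h [hint hE hD]] := abs_continuous_seq_derive ab (abs_continuous_seqM leab acf acg).
have sub k : mu.-integrable setT (EFin \o k) -> mu.-integrable `[a, b] (EFin \o k).
  by move=> kint; exact: integrableS kint.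
have ghf := integrable_continuousM leab (abs_continuous_seq_continuous leab acg) (sub _ hfint).
have fhg := integrable_continuousM leab (abs_continuous_seq_continuous leab acf) (sub _ hgint).
rewrite hE ?leab ?lexx//.
(* The derivatives are replaced by densities, which are known to be integrable. *)
rewrite (@Rintegral_ae_eqW _ _ _ mu _ _ (fun x => g x * hf x)); last first.
  apply: filterS hfD => x hfD /hfD hfx.
  by rewrite derive1E derive_val mulrC.
rewrite (@Rintegral_ae_eqW _ _ _ mu _ (fun x => f x * derive1 g x)
  (fun x => f x * hg x)); last first.
  apply: filterS hgD => x hgD /hgD hgx.
  by rewrite derive1E derive_val.
(* Both functions are almost everywhere the derivative of [f g], and derivatives are unique. *)
rewrite (@Rintegral_ae_eqW _ _ _ mu _ h (fun x => g x * hf x + f x * hg x)); last first.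
  apply: filterS3 hfD hgD hD => x hfD hgD hD xab.
  have hfx := hfD xab; have hgx := hgD xab; have hx := hD xab.
  have := @is_deriveM _ _ f g x 1 _ _ hfx hgx.
  move=> H; rewrite -(@derive_val _ _ _ _ _ _ _ hx) (@derive_val _ _ _ _ _ _ _ H).
  by rewrite addrC.
by rewrite RintegralD// addrK.
Qed.

End abs_continuous_calculus.

(** * Exchange of integrals over a triangle *)

Section Rintegral_complements.
Context {d : measure_display} {T : measurableType d} {R : realType}.
Variable mu : {measure set T -> \bar R}.

Lemma integrable_EFinZl (D : set T) (c : R) (f : T -> R) : measurable D ->
  mu.-integrable D (EFin \o f) -> mu.-integrable D (EFin \o (fun x => c * f x)).
Proof.
move=> mD fint.
have -> : EFin \o (fun x => c * f x) = (fun x => c%:E * (EFin \o f) x)%E.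
  by apply/funext => x /=; rewrite EFinM.
exact: integrableZl.
Qed.

(* Also for non-integrable [f]: then both sides are [0], the value of [fine] at infinity. *)
Lemma RintegralZl_measurable (D : set T) (c : R) (f : T -> R) : measurable D ->
  measurable_fun D (fun x => c * f x) ->
  Rintegral mu D (fun x => c * f x) = c * Rintegral mu D f.
Proof.
(* For nonzero [c], measurability and integrability pass between [f] and its multiple; for zero both
   sides vanish. *)
move=> mD mcf; have [->|c0] := eqVneq c 0.
  rewrite mul0r /Rintegral integral0_eq// => x _; by rewrite mul0r.
have mf : measurable_fun D f.
  have -> : f = (fun x => c^-1 * (c * f x)).
    by apply/funext => x; rewrite mulrA mulVf// mul1r.
  exact: measurable_funM.
have [fint|fint] := pselect (mu.-integrable D (EFin \o f)).
  exact: RintegralZl.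
have int0 (g : T -> R) : measurable_fun D g -> ~ mu.-integrable D (EFin \o g) ->
    Rintegral mu D g = 0.
  move=> mg gint; rewrite /Rintegral.
  have : ~ (\int[mu]_(x in D) (g x)%:E)%E \is a fin_num.
    rewrite -integral_fin_num_abs// => gfin; apply: gint.
    by apply/integrableP; split => //; exact/measurable_EFinP.
  by case: (\int[mu]_(x in D) (g x)%:E)%E.
rewrite !int0 ?mulr0// => cfint; apply: fint.
have -> : f = (fun x => c^-1 * (c * f x)).
  by apply/funext => x; rewrite mulrA mulVf// mul1r.
exact: integrable_EFinZl.
Qed.

(** An integrable function is finite almost everywhere, so [fine] changes it only on a null set. *)
Lemma integrable_fine (F : T -> \bar R) : mu.-integrable setT F ->
  mu.-integrable setT (EFin \o (fine \o F)) /\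
  (\int[mu]_x (fine (F x))%:E = \int[mu]_x F x)%E.
Proof.
move=> Fint; have Ffin := integrable_ae measurableT Fint.
have mF := measurable_int mu Fint.
have aeF : {ae mu, forall x, setT x -> (fine (F x))%:E = F x}.
  by apply: filterS Ffin => x h _; rewrite fineK ?h.
have mfF : measurable_fun setT (EFin \o (fine \o F)).
  by apply/measurable_EFinP; exact: measurableT_comp.
split; last exact: integral_ae_eqW.
apply: le_integrable Fint => // x _ /=.
by case: (F x) => [r| |] //=; rewrite ?normr0 leey.
Qed.

End Rintegral_complements.

Section fubini_complements.
Context {d1 d2 : measure_display} {T1 : measurableType d1} {T2 : measurableType d2}.
Context {R : realType}.
Variables (m1 : {sigma_finite_measure set T1 -> \bar R}).
Variables (m2 : {sigma_finite_measure set T2 -> \bar R}).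

(** The inner integral is dominated by that of the absolute value, whose iterated integral is
    finite. *)
Lemma integrable_fubini_G (f : T1 * T2 -> \bar R) :
  ((m1 \x m2)%E).-integrable setT f -> m2.-integrable setT (fubini_G m1 f).
Proof.
move=> fint; have mf := measurable_int _ fint; have mG := measurable_fubini_G fint.
have mabs : measurable_fun setT (abse \o f) by exact: measurableT_comp.
apply/integrableP; split => //.
apply: le_lt_trans ((integrable21ltyP _ _ mf).1 fint).
apply: ge0_le_integral => //.
- exact: measurableT_comp.
- by apply: (measurable_fun_fubini_tonelli_G (abse \o f)) => //=.
- move=> y _; apply: le_abse_integral => //.
  exact: measurable_fun_pair1.
Qed.

End fubini_complements.

(** * Fubini on the triangle *)

Section triangle.
Context {R : realType}.
Local Notation mu := (@lebesgue_measure R).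
Variables (a b : R) (k : R -> R -> R) (u v : R -> R).

Definition triangle (z : R * R) : bool := [&& a <= z.2, z.2 <= z.1 & z.1 <= b].

(** Extended by zero, so that Fubini applies on the whole plane and the variable bounds of
    integration disappear. *)
Definition triangle_integrand (z : R * R) : R :=
  if triangle z then u z.1 * (k z.1 z.2 * v z.2) else 0.

Local Notation F := triangle_integrand.

Hypothesis Fint : ((mu \x mu)%E).-integrable setT (EFin \o F).

Let mF : measurable_fun setT F.
Proof. by apply/measurable_EFinP; exact: (measurable_int _ Fint). Qed.

(** Integrability on the plane concerns only almost every slice, so the factor [u x] is taken out by
    [RintegralZl_measurable], for which measurability of the slice suffices. *)
Let slice1 x : x \in `[a, b] ->
  u x * Rintegral mu `[a, x] (fun t => k x t * v t) = Rintegral mu setT (fun t => F (x, t)).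
Proof.
rewrite in_itv/= => /andP[ax xb].
have FE t : `[a, x]%classic t -> F (x, t) = u x * (k x t * v t).
  by rewrite /= in_itv/= /F /triangle /= xb andbT => ->.
rewrite -RintegralZl_measurable//; last first.
  apply: (@eq_measurable_fun _ _ _ _ _ (fun t => F (x, t))).
    by move=> t /set_mem/FE.
  by apply: measurable_funTS; exact: measurable_fun_pair2.
rewrite Rintegral_mkcond; apply: eq_Rintegral => t _; rewrite patchE.
case: ifPn => [/set_mem/FE//|]; rewrite notin_setE /= in_itv/= => /negP tx.
by rewrite /F /triangle /= xb andbT (negbTE tx).
Qed.

Let slice2 t : t \in `[a, b] ->
  v t * Rintegral mu `[t, b] (fun x => k x t * u x) = Rintegral mu setT (fun x => F (x, t)).
Proof.
rewrite in_itv/= => /andP[at_ tb].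
have FE x : `[t, b]%classic x -> F (x, t) = v t * (k x t * u x).
  by rewrite /= in_itv/= /F /triangle /= at_ /= => ->; ring.
rewrite -RintegralZl_measurable//; last first.
  apply: (@eq_measurable_fun _ _ _ _ _ (fun x => F (x, t))).
    by move=> x /set_mem/FE.
  by apply: measurable_funTS; exact: measurable_fun_pair1.
rewrite Rintegral_mkcond; apply: eq_Rintegral => x _; rewrite patchE.
case: ifPn => [/set_mem/FE//|]; rewrite notin_setE /= in_itv/= => /negP tx.
by rewrite /F /triangle /= at_ /= (negbTE tx).
Qed.

Let out1 x : x \notin `[a, b] -> Rintegral mu setT (fun t => F (x, t)) = 0.
Proof.
move=> xab; rewrite /Rintegral integral0_eq// => t _.
rewrite /F; case: ifPn => // /and3P[/= at_ tx xb].
by move: xab; rewrite in_itv/= xb (le_trans at_ tx).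
Qed.

Let out2 t : t \notin `[a, b] -> Rintegral mu setT (fun x => F (x, t)) = 0.
Proof.
move=> xab; rewrite /Rintegral integral0_eq// => x _.
rewrite /F; case: ifPn => // /and3P[/= at_ tx xb].
by move: xab; rewrite in_itv/= at_ (le_trans tx xb).
Qed.

Let patch1 : (fun x => u x * Rintegral mu `[a, x] (fun t => k x t * v t)) \_ `[a, b] =
  fine \o fubini_F mu (EFin \o F).
Proof.
apply/funext => x; rewrite patchE; case: ifPn => xab.
  by apply: slice1; move/set_mem : xab.
by rewrite -[RHS]/(Rintegral mu setT (fun t => F (x, t))) out1//; apply: contra xab => /mem_set.
Qed.

Let patch2 : (fun t => v t * Rintegral mu `[t, b] (fun x => k x t * u x)) \_ `[a, b] =
  fine \o fubini_G mu (EFin \o F).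
Proof.
apply/funext => x; rewrite patchE; case: ifPn => xab.
  by apply: slice2; move/set_mem : xab.
by rewrite -[RHS]/(Rintegral mu setT (fun t => F (t, x))) out2//; apply: contra xab => /mem_set.
Qed.

Lemma triangle_integrable1 : mu.-integrable `[a, b]
  (EFin \o (fun x => u x * Rintegral mu `[a, x] (fun t => k x t * v t))).
Proof.
apply/integrable_mkcond => //; rewrite restrict_EFin patch1.
exact: (integrable_fine (integrable_fubini_F Fint)).1.
Qed.

Lemma triangle_integrable2 : mu.-integrable `[a, b]
  (EFin \o (fun t => v t * Rintegral mu `[t, b] (fun x => k x t * u x))).
Proof.
apply/integrable_mkcond => //; rewrite restrict_EFin patch2.
exact: (integrable_fine (integrable_fubini_G Fint)).1.
Qed.

(** After extension by zero, the two sides are the iterated integrals of one integrable function on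
    the plane. *)
Lemma triangle_swap :
  Rintegral mu `[a, b] (fun x => u x * Rintegral mu `[a, x] (fun t => k x t * v t)) =
  Rintegral mu `[a, b] (fun t => v t * Rintegral mu `[t, b] (fun x => k x t * u x)).
Proof.
rewrite Rintegral_mkcond patch1 [RHS]Rintegral_mkcond patch2 /Rintegral /=.
rewrite (integrable_fine (integrable_fubini_F Fint)).2.
rewrite (integrable_fine (integrable_fubini_G Fint)).2.
by congr fine; exact: Fubini.
Qed.

End triangle.

(** * Integrability over the triangle *)

Section lebesgue_measure_change_of_variable.
Context {R : realType}.
Local Notation mu := (@lebesgue_measure R).

(** The pushforward by [phi] gives half-open intervals their length, so it is the Lebesgue measure
    by uniqueness. *)
Lemma lebesgue_measure_preserving (phi : measurableTypeR R -> measurableTypeR R) :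
  measurable_fun setT phi ->
  (forall s t : R, s < t -> mu (phi @^-1` `]s, t]%classic) = (t - s)%:E) ->
  forall f : measurableTypeR R -> \bar R, measurable_fun setT f ->
  (forall x, (0 <= f x)%E) ->
  (\int[mu]_x f (phi x) = \int[mu]_x f x)%E.
Proof.
move=> mphi phiE f mf f0.
transitivity (\int[pushforward mu phi]_x f x)%E.
  by rewrite ge0_integral_pushforward.
apply: eq_measure_integral => A mA _; apply/esym.
move: A mA; apply: lebesgue_measure_unique => _ [[s t] _ <-] /=.
rewrite /pushforward; have [st|ts] := ltP s t.
  by rewrite phiE// lebesgue_measure_itv/= lte_fin st EFinB.
by rewrite set_itv_ge ?bnd_simp -?leNgt// preimage_set0 !measure0.
Qed.

Lemma ge0_integral_shift (c : R) (f : R -> \bar R) : measurable_fun setT f ->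
  (forall x, (0 <= f x)%E) -> (\int[mu]_x f (x - c)%R = \int[mu]_x f x)%E.
Proof.
move=> mf f0; apply: (@lebesgue_measure_preserving (fun x : R => x - c)) => //.
  exact: measurable_funB.
move=> s t st; rewrite (_ : _ @^-1` _ = `]s + c, t + c]%classic).
  by rewrite lebesgue_measure_itv/= lte_fin ltrD2r st -EFinD; congr EFin; ring.
by apply/seteqP; split => x /=; rewrite !in_itv/= ltrBrDr lerBlDr.
Qed.

Lemma ge0_integral_reflect (c : R) (f : R -> \bar R) : measurable_fun setT f ->
  (forall x, (0 <= f x)%E) -> (\int[mu]_x f (c - x)%R = \int[mu]_x f x)%E.
Proof.
move=> mf f0; apply: (@lebesgue_measure_preserving (fun x : R => c - x)) => //.
  exact: measurable_funB.
move=> s t st; rewrite (_ : _ @^-1` _ = `[c - t, c - s[%classic).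
  by rewrite lebesgue_measure_itv/= lte_fin ltrD2l ltrN2 st -EFinD; congr EFin; ring.
by apply/seteqP; split => x /=; rewrite !in_itv/= => /andP[h1 h2]; apply/andP; split; lra.
Qed.

End lebesgue_measure_change_of_variable.

(** * Integrability of the triangle integrand under either hypothesis *)

Section triangle_integrable.
Context {R : realType}.
Local Notation mu := (@lebesgue_measure R).
Implicit Types (a b : R) (k : R -> R -> R) (u v : R -> R).

Lemma measurable_triangle a b : measurable_fun setT (triangle a b).
Proof.
rewrite /triangle; apply: measurable_and; first exact: measurable_fun_ler.
by apply: measurable_and; exact: measurable_fun_ler.
Qed.

Lemma measurable_triangle_integrand a b k u v :
  measurable_fun setT (fun z : R * R => k z.1 z.2) ->
  measurable_fun setT u -> measurable_fun setT v ->
  measurable_fun setT (triangle_integrand a b k u v).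
Proof.
move=> mk mu' mv; apply: measurable_fun_ifT => //; first exact: measurable_triangle.
apply: measurable_funM; first exact: measurableT_comp.
by apply: measurable_funM => //; exact: measurableT_comp.
Qed.

(** Allows the data to be replaced by extensions by zero, which are measurable on the whole
    space. *)
Lemma eq_triangle_integrand a b k k' u u' v v' :
  (forall x t, a <= t -> t <= x -> x <= b -> k x t = k' x t) ->
  (forall x, a <= x <= b -> u x = u' x) ->
  (forall x, a <= x <= b -> v x = v' x) ->
  triangle_integrand a b k u v = triangle_integrand a b k' u' v'.
Proof.
move=> kk' uu' vv'; apply/funext => -[x t]; rewrite /triangle_integrand /triangle /=.
case: ifPn => // /and3P[at_ tx xb].
by rewrite kk'// uu' ?vv'// ?at_ ?xb ?andbT ?(le_trans at_)// ?(le_trans tx).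
Qed.

(** Tonelli: integrating the slice bound once more gives a finite iterated integral of the absolute
    value. *)
Lemma integrable_le_slice1 (F : R * R -> R) (w : R -> R) (C : R) :
  measurable_fun setT F -> mu.-integrable setT (EFin \o w) -> 0 <= C ->
  (forall x, \int[mu]_y `|(F (x, y))%:E| <= C%:E * `|(w x)%:E|)%E ->
  ((mu \x mu)%E).-integrable setT (EFin \o F).
Proof.
move=> mF /integrableP[/measurable_EFinP mw woo] C0 FC.
have mEF : measurable_fun setT (EFin \o F) by exact/measurable_EFinP.
have mnw : measurable_fun setT (fun x => `|(w x)%:E|%E).
  by apply/measurable_EFinP; exact: measurableT_comp.
apply/integrable12ltyP => //.
apply: (@le_lt_trans _ _ (\int[mu]_x (C%:E * `|(w x)%:E|))%E).
  apply: ge0_le_integral => //.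
  - by move=> z _; exact: integral_ge0.
  - apply: (@measurable_fun_fubini_tonelli_F _ _ (measurableTypeR R)
      (measurableTypeR R) R mu (abse \o (EFin \o F))) => //=.
    exact: measurableT_comp.
  - exact: measurable_funeM.
  - by move=> z _; exact: FC.
rewrite ge0_integralZl//; apply: lte_mul_pinfty => //; exact: woo.
Qed.

Lemma integrable_le_slice2 (F : R * R -> R) (w : R -> R) (C : R) :
  measurable_fun setT F -> mu.-integrable setT (EFin \o w) -> 0 <= C ->
  (forall y, \int[mu]_x `|(F (x, y))%:E| <= C%:E * `|(w y)%:E|)%E ->
  ((mu \x mu)%E).-integrable setT (EFin \o F).
Proof.
move=> mF /integrableP[/measurable_EFinP mw woo] C0 FC.
have mEF : measurable_fun setT (EFin \o F) by exact/measurable_EFinP.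
have mnw : measurable_fun setT (fun x => `|(w x)%:E|%E).
  by apply/measurable_EFinP; exact: measurableT_comp.
apply/integrable21ltyP => //.
apply: (@le_lt_trans _ _ (\int[mu]_x (C%:E * `|(w x)%:E|))%E).
  apply: ge0_le_integral => //.
  - by move=> z _; exact: integral_ge0.
  - apply: (@measurable_fun_fubini_tonelli_G _ _ (measurableTypeR R)
      (measurableTypeR R) R mu (abse \o (EFin \o F))) => //=.
    exact: measurableT_comp.
  - exact: measurable_funeM.
  - by move=> z _; exact: FC.
rewrite ge0_integralZl//; apply: lte_mul_pinfty => //; exact: woo.
Qed.

Lemma integrable_norm_integral (f : R -> R) : mu.-integrable setT (EFin \o f) ->
  exists2 C : R, 0 <= C & (\int[mu]_x `|(f x)%:E| = C%:E)%E.
Proof.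
move=> /integrableP[_ foo].
exists (fine (\int[mu]_x `|(f x)%:E|)%E); first by rewrite fine_ge0// integral_ge0.
by rewrite fineK// ge0_fin_numE// integral_ge0.
Qed.

Lemma integral_norm_mulr (h : R -> R) (c C : R) : measurable_fun setT h ->
  (\int[mu]_x `|(h x)%:E| = C%:E)%E ->
  (\int[mu]_x `|(h x * c)%:E| = C%:E * `|c%:E|)%E.
Proof.
move=> mh hC.
under eq_integral do rewrite EFinM abseM muleC.
rewrite ge0_integralZl//; first by rewrite hC muleC.
by apply/measurable_EFinP; exact: measurableT_comp.
Qed.

Lemma integrable_prod (f g : R -> R) :
  mu.-integrable setT (EFin \o f) -> mu.-integrable setT (EFin \o g) ->
  ((mu \x mu)%E).-integrable setT (EFin \o (fun z : R * R => f z.1 * g z.2)).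
Proof.
move=> fint gint.
have mf : measurable_fun setT f by apply/measurable_EFinP; exact: measurable_int fint.
have mg : measurable_fun setT g by apply/measurable_EFinP; exact: measurable_int gint.
have [C C0 CE] := integrable_norm_integral fint.
apply: (integrable_le_slice2 _ gint C0).
  apply: measurable_funM; exact: measurableT_comp.
by move=> y; rewrite -(integral_norm_mulr (g y) mf CE).
Qed.

Lemma measurable_difference (h : R -> R) : measurable_fun setT h ->
  measurable_fun setT (fun z : R * R => h (z.1 - z.2)).
Proof. by move=> mh; apply: measurableT_comp => //; exact: measurable_funB. Qed.

(** For fixed [x], the reflection sending [t] to [x - t] preserves the measure, so the slice
    integral is the norm of [h] times that of [w x]. *)
Lemma integrable_convolution1 (h w : R -> R) :
  mu.-integrable setT (EFin \o h) -> mu.-integrable setT (EFin \o w) ->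
  ((mu \x mu)%E).-integrable setT (EFin \o (fun z : R * R => h (z.1 - z.2) * w z.1)).
Proof.
move=> hint wint.
have mh : measurable_fun setT h by apply/measurable_EFinP; exact: measurable_int hint.
have mw : measurable_fun setT w by apply/measurable_EFinP; exact: measurable_int wint.
have [C C0 CE] := integrable_norm_integral hint.
apply: (integrable_le_slice1 _ wint C0).
  apply: measurable_funM; first exact: measurable_difference.
  exact: measurableT_comp.
move=> x; rewrite -(@integral_norm_mulr (fun t => h (x - t)) (w x) C)//.
  by apply: measurableT_comp => //; exact: measurable_funB.
rewrite -CE; apply: (@ge0_integral_reflect _ x (fun y => `|(h y)%:E|%E)) => //.
by apply/measurable_EFinP; exact: measurableT_comp.
Qed.

(** Here the slices have [t] fixed, and translation invariance replaces reflection. *)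
Lemma integrable_convolution2 (h w : R -> R) :
  mu.-integrable setT (EFin \o h) -> mu.-integrable setT (EFin \o w) ->
  ((mu \x mu)%E).-integrable setT (EFin \o (fun z : R * R => h (z.1 - z.2) * w z.2)).
Proof.
move=> hint wint.
have mh : measurable_fun setT h by apply/measurable_EFinP; exact: measurable_int hint.
have mw : measurable_fun setT w by apply/measurable_EFinP; exact: measurable_int wint.
have [C C0 CE] := integrable_norm_integral hint.
apply: (integrable_le_slice2 _ wint C0).
  apply: measurable_funM; first exact: measurable_difference.
  exact: measurableT_comp.
move=> t; rewrite -(@integral_norm_mulr (fun x => h (x - t)) (w t) C)//.
  by apply: measurableT_comp => //; exact: measurable_funB.
rewrite -CE; apply: (@ge0_integral_shift _ t (fun y => `|(h y)%:E|%E)) => //.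
by apply/measurable_EFinP; exact: measurableT_comp.
Qed.

Lemma integrable_patch a b (h : R -> R) : mu.-integrable `[a, b] (EFin \o h) ->
  mu.-integrable setT (EFin \o (h \_ `[a, b])).
Proof.
move=> hint; rewrite -restrict_EFin.
exact: ((@integrable_mkcond _ (measurableTypeR R) R mu _ _ (measurable_itv `[a, b])).1 hint).
Qed.

(** The integrand is dominated by a convolution kernel. The two alternatives say which variable
    carries the dominating function [w], so that either order of the two factors is covered. *)
Lemma integrable_triangle_difference a b (kappa : R -> R) k u v (w : R -> R) (M : R) :
  (forall x t, x \in `[a, b] -> t \in `[a, b] -> k x t = kappa (x - t)) ->
  mu.-integrable `[0, b - a] (EFin \o kappa) ->
  measurable_fun `[a, b] u -> measurable_fun `[a, b] v -> L1on a b w ->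
  (forall x t, x \in `[a, b] -> t \in `[a, b] -> `|u x * v t| <= M * `|w x|) \/
  (forall x t, x \in `[a, b] -> t \in `[a, b] -> `|u x * v t| <= M * `|w t|) ->
  ((mu \x mu)%E).-integrable setT (EFin \o triangle_integrand a b k u v).
Proof.
move=> kE kint mu' mv wint bound.
pose h := kappa \_ `[0, b - a]; pose w0 := w \_ `[a, b].
pose u0 := u \_ `[a, b]; pose v0 := v \_ `[a, b].
have inab (w' : R -> R) x : a <= x <= b -> (w' \_ `[a, b]) x = w' x.
  by move=> xab; rewrite patchE mem_set//= in_itv.
have hint : mu.-integrable setT (EFin \o h) by exact: integrable_patch.
have w0int : mu.-integrable setT (EFin \o w0) by exact: integrable_patch.
have mh : measurable_fun setT h by apply/measurable_EFinP; exact: measurable_int hint.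
have mu0 : measurable_fun setT u0 by exact/(measurable_restrictT _ (measurable_itv _)).
have mv0 : measurable_fun setT v0 by exact/(measurable_restrictT _ (measurable_itv _)).
(* On the triangle [x - t] lies in [[0, b - a]], where the extension [h] agrees with [kappa]. *)
have hE x t : a <= t -> t <= x -> x <= b -> h (x - t) = k x t.
  move=> at_ tx xb; rewrite kE ?in_itv/= ?xb ?at_ ?(le_trans at_ tx) ?(le_trans tx xb)//.
  rewrite /h patchE mem_set//= in_itv/=; apply/andP; split; lra.
have mT : measurable_fun setT (EFin \o triangle_integrand a b k u v).
  rewrite (@eq_triangle_integrand a b k (fun x t => h (x - t)) u u0 v v0).
  - apply/measurable_EFinP; apply: measurable_triangle_integrand => //.
    exact: measurable_difference.
  - by move=> x t at_ tx xb; rewrite hE.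
  - by move=> x xab; rewrite /u0 inab.
  - by move=> x xab; rewrite /v0 inab.
case: bound => bound.
- have := integrableZl measurableT M (integrable_convolution1 hint w0int).
  apply: le_integrable => // -[x t] _ /=; rewrite lee_fin /triangle_integrand /triangle /=.
  case: ifPn => [/and3P[at_ tx xb]|_]; last by rewrite normr0.
  have ax := le_trans at_ tx; have tb := le_trans tx xb.
  rewrite hE// /w0 inab ?ax//.
  rewrite (_ : u x * _ = k x t * (u x * v t)); last by ring.
  rewrite (_ : M * _ = k x t * (M * w x)); last by ring.
  rewrite normrM [leRHS]normrM ler_wpM2l// [leRHS]normrM.
  apply: le_trans (bound x t _ _) _; rewrite ?in_itv/= ?ax ?at_//.
  by rewrite ler_wpM2r// ler_norm.
- have := integrableZl measurableT M (integrable_convolution2 hint w0int).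
  apply: le_integrable => // -[x t] _ /=; rewrite lee_fin /triangle_integrand /triangle /=.
  case: ifPn => [/and3P[at_ tx xb]|_]; last by rewrite normr0.
  have ax := le_trans at_ tx; have tb := le_trans tx xb.
  rewrite hE// /w0 inab ?at_//.
  rewrite (_ : u x * _ = k x t * (u x * v t)); last by ring.
  rewrite (_ : M * _ = k x t * (M * w t)); last by ring.
  rewrite normrM [leRHS]normrM ler_wpM2l// [leRHS]normrM.
  apply: le_trans (bound x t _ _) _; rewrite ?in_itv/= ?ax ?at_//.
  by rewrite ler_wpM2r// ler_norm.
Qed.

Lemma integrable_triangle_L2 a b k u v :
  measurable_fun (`[a, b] `*` `[a, b]) (fun z : R * R => k z.1 z.2) ->
  ((mu \x mu)%E).-integrable (`[a, b] `*` `[a, b])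
    (fun z : R * R => ((k z.1 z.2) ^+ 2)%:E) ->
  L2on a b u -> L2on a b v ->
  ((mu \x mu)%E).-integrable setT (EFin \o triangle_integrand a b k u v).
Proof.
move=> mk k2int [mu' u2int] [mv v2int].
pose D : set (R * R) := `[a, b] `*` `[a, b].
have mD : measurable D by exact: measurableX.
pose kD := (fun z : R * R => k z.1 z.2) \_ D.
pose u0 := u \_ `[a, b]; pose v0 := v \_ `[a, b].
have inab x : a <= x <= b -> x \in `[a, b]%classic by move=> xab; rewrite inE /= in_itv.
have -> : triangle_integrand a b k u v =
          triangle_integrand a b (fun x t => kD (x, t)) u0 v0.
  apply: eq_triangle_integrand => [x t at_ tx xb|x xab|x xab]; last 2 first.
  - by rewrite /u0 patchE inab.
  - by rewrite /v0 patchE inab.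
  rewrite /kD patchE mem_set//; split; rewrite /= in_itv/= ?xb ?at_ ?andbT/=.
    exact: le_trans tx.
  exact: le_trans xb.
have mkD : measurable_fun setT kD by exact/(measurable_restrictT _ mD).
have mu0 : measurable_fun setT u0 by exact/(measurable_restrictT _ (measurable_itv _)).
have mv0 : measurable_fun setT v0 by exact/(measurable_restrictT _ (measurable_itv _)).
have sq (w : R -> R) : mu.-integrable `[a, b] (fun x => ((w x) ^+ 2)%:E) ->
    mu.-integrable setT (EFin \o (fun x => ((w \_ `[a, b]) x) ^+ 2)).
  move=> w2.
  move: ((@integrable_mkcond _ (measurableTypeR R) R mu _ _ (measurable_itv `[a, b])).1 w2).
  apply: eq_integrable => // x _ /=.
  by rewrite !patchE; case: ifPn => //; rewrite expr0n.
have kD2 : ((mu \x mu)%E).-integrable setT (EFin \o (fun z => kD z ^+ 2)).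
  have := (@integrable_mkcond _ (measurableTypeR R * measurableTypeR R)%type R
    (mu \x mu)%E _ _ mD).1 k2int.
  apply: eq_integrable => // x _ /=.
  by rewrite /kD !patchE; case: ifPn => //; rewrite expr0n.
(* The square of [u0 x * v0 t] is a product of integrable functions of separate variables. *)
have uv2 := integrable_prod (sq _ u2int) (sq _ v2int).
have := integrableD measurableT kD2 uv2; apply: le_integrable => //.
  apply/measurable_EFinP; apply: measurable_triangle_integrand => //.
move=> -[x t] _ /=; rewrite lee_fin /triangle_integrand /=.
have ge0 : 0 <= kD (x, t) ^+ 2 + u0 x ^+ 2 * v0 t ^+ 2.
  by apply: addr_ge0; [exact: sqr_ge0|apply: mulr_ge0; exact: sqr_ge0].
rewrite (ger0_norm ge0); case: ifPn => _; last by rewrite normr0.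
rewrite mulrCA normrM -exprMn -real_normK ?num_real// -[X in _ <= _ + X]real_normK ?num_real//.
(* The square of the difference bounds twice the product by the sum of squares; the square of the
   sum helps absorb the factor 2. *)
have := sqr_ge0 (`|kD (x, t)| - `|u0 x * v0 t|).
have := sqr_ge0 (`|kD (x, t)| + `|u0 x * v0 t|).
nra.
Qed.

End triangle_integrable.

(** * Adjointness and integration by parts *)

Section adjoint.
Context {R : realType}.
Local Notation mu := (@lebesgue_measure R).

(** Swapping the order of integration turns the left-sided term of one operator into the right-sided
    term of the other, which exchanges [p] and [q]. The [p] term uses the integrand of [g, h], the
    [q] term that of [h, g]. *)
Lemma KP_adjoint (a b p q : R) (k : R -> R -> R) (g h : R -> R) :
  ((mu \x mu)%E).-integrable setT (EFin \o triangle_integrand a b k g h) ->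
  ((mu \x mu)%E).-integrable setT (EFin \o triangle_integrand a b k h g) ->
  Rintegral mu `[a, b] (fun x => g x * KP a b p q k h x) =
  Rintegral mu `[a, b] (fun x => h x * KP a b q p k g x).
Proof.
move=> ghint hgint.
have split_KP (p' q' : R) (u v : R -> R) :
    ((mu \x mu)%E).-integrable setT (EFin \o triangle_integrand a b k u v) ->
    ((mu \x mu)%E).-integrable setT (EFin \o triangle_integrand a b k v u) ->
    Rintegral mu `[a, b] (fun x => u x * KP a b p' q' k v x) =
    p' * Rintegral mu `[a, b]
      (fun x => u x * Rintegral mu `[a, x] (fun t => k x t * v t)) +
    q' * Rintegral mu `[a, b]
      (fun t => u t * Rintegral mu `[t, b] (fun x => k x t * v x)).
  move=> uvint vuint.
  have int1 := triangle_integrable1 uvint; have int2 := triangle_integrable2 vuint.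
  rewrite -!RintegralZl// -RintegralD//.
  - by apply: eq_Rintegral => x _; rewrite /KP; ring.
  - exact: integrable_EFinZl.
  - exact: integrable_EFinZl.
rewrite !split_KP// (triangle_swap ghint) (triangle_swap hgint); ring.
Qed.

Lemma L1on_measurable (a b : R) (h : R -> R) : L1on a b h -> measurable_fun `[a, b] h.
Proof. by move=> hint; apply/measurable_EFinP; exact: measurable_int hint. Qed.

(** Continuity bounds [g] on [[a, b]], so the product of the factors is dominated by a multiple of
    [h] in its own variable. *)
Lemma integrable_triangle_L1_continuous (a b : R) (kappa : R -> R) k g h : a <= b ->
  (forall x t, x \in `[a, b] -> t \in `[a, b] -> k x t = kappa (x - t)) ->
  mu.-integrable `[0, b - a] (EFin \o kappa) ->
  L1on a b h -> {within `[a, b], continuous g} ->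
  ((mu \x mu)%E).-integrable setT (EFin \o triangle_integrand a b k g h) /\
  ((mu \x mu)%E).-integrable setT (EFin \o triangle_integrand a b k h g).
Proof.
move=> ab kE kint hint cg; have [M M0 gM] := continuous_within_bounded ab cg.
have mg : measurable_fun `[a, b] g by exact: subspace_continuous_measurable_fun.
have mh := L1on_measurable hint.
have bound x t : x \in `[a, b] -> `|g x * h t| <= M * `|h t|.
  by rewrite in_itv/= => /gM gx; rewrite normrM ler_wpM2r.
split; apply: (integrable_triangle_difference kE kint _ _ hint) => //.
  by right => x t xab _; exact: bound.
by left => x t xab tab; rewrite mulrC; exact: bound.
Qed.

End adjoint.

Theorem mainTheorem5 (R : realType) (a b alpha p q : R)
    (k : R -> R -> R) (f g : R -> R) :
  a < b -> 0 < alpha < 1 ->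
  abs_continuous_on a b f ->
  abs_continuous_on a b (KP a b q p k g) ->
  ( (* (i) k square integrable on [a,b]x[a,b], f', g in L_2([a,b]) *)
    (measurable_fun (`[a, b] `*` `[a, b]) (fun z : R * R => k z.1 z.2) /\
     ((lebesgue_measure \x lebesgue_measure)%E).-integrable
        (`[a, b] `*` `[a, b]) (fun z : R * R => ((k z.1 z.2) ^+ 2)%:E) /\
     L2on a b (derive1 f) /\ L2on a b g)
  \/
    (* (ii) difference kernel in L_1([0,b-a]), f' in L_1, g continuous *)
    ((exists kappa : R -> R,
        (forall x t, x \in `[a, b] -> t \in `[a, b] -> k x t = kappa (x - t)) /\
        lebesgue_measure.-integrable `[0, b - a] (fun x => (kappa x)%:E)) /\
     L1on a b (derive1 f) /\ {within `[a, b], continuous g}) ) ->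
  Rintegral lebesgue_measure `[a, b] (fun x => g x * BP a b p q k f x)
  = f b * KP a b q p k g b - f a * KP a b q p k g a
    - Rintegral lebesgue_measure `[a, b] (fun x => f x * AP a b q p k g x).
Proof.
(* Integration by parts for [f] and [KP a b q p k g] reduces the claim to adjointness with [h] the
   derivative of [f]. *)
move=> ab _ acf acK hyp; rewrite -abs_continuous_integration_by_parts//.
apply: KP_adjoint.
  case: hyp => [[mk [k2 [f2 g2]]]|[[kappa [kE kint]] [f1 cg]]].
    exact: integrable_triangle_L2.
  exact: (integrable_triangle_L1_continuous (ltW ab) kE kint f1 cg).1.
case: hyp => [[mk [k2 [f2 g2]]]|[[kappa [kE kint]] [f1 cg]]].
  exact: integrable_triangle_L2.
exact: (integrable_triangle_L1_continuous (ltW ab) kE kint f1 cg).2.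
Qed.
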